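(* Suppose $C\in\mathcal{C}^3_{\rm c}$ satisfies $d_\infty(C,\psi(C))\neq0$. Then $C$ is a discontinuity point of the mapping $\psi:\mathcal{C}^3_{\rm c}\to\mathcal{C}^3_{\rm c}$ (with $d_\infty$ on both domain and codomain). In other words, every non-simplified $C\in\mathcal{C}^3_{\rm c}$ is a discontinuity point of $\psi$.
   Context: $\mathbb{I}=[0,1]$, $\lambda$ Lebesgue measure; $d_\infty(C_1,C_2)=\max_{\mathbf{x}\in\mathbb{I}^3}|C_1(\mathbf{x})-C_2(\mathbf{x})|$. Points of $\mathbb{I}^3$ are written $(\mathbf{u},v)$, $\mathbf{u}=(u_1,u_2)$. For a three-dimensional copula $C$, $K_C$ is (a version of) the regular conditional distribution of $(U_1,U_2)$ given $U_3=v$, $(U_1,U_2,U_3)\sim C$; $F_{1|3}(u_1|t)=K_C(t,[0,u_1]\times\mathbb{I})$, $F_{2|3}(u_2|t)=K_C(t,\mathbb{I}\times[0,u_2])$. $\mathcal{C}^3_{\rm c}$ is the set of three-dimensional copulas for which $F_{1|3}(\cdot|t)$ and $F_{2|3}(\cdot|t)$ are continuous for $\lambda$-a.e. $t$; for such $C$, for a.e. $t$ the conditional copula $C^t_{12;3}$ is the unique bivariate copula with $K_C(t,[\mathbf{0},\mathbf{u}])=C^t_{12;3}(F_{1|3}(u_1|t),F_{2|3}(u_2|t))$. $C\in\mathcal{C}^3_{\rm c}$ is simplified if there is a bivariate copula $A$ with $C(\mathbf{u},v)=\int_{[0,v]}A(F_{1|3}(u_1|t),F_{2|3}(u_2|t))\,d\lambda(t)$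 for all $(\mathbf{u},v)$. The partial copula is $C_p(\mathbf{s})=\int_{\mathbb{I}}C^t_{12;3}(\mathbf{s})\,d\lambda(t)$ and $\psi(C)(\mathbf{u},v)=\int_{[0,v]}C_p(F_{1|3}(u_1|t),F_{2|3}(u_2|t))\,d\lambda(t)$ (the partial vine copula of $C$). *)

(* Defs.v *)
From HB Require Import structures.
From mathcomp Require Import all_boot all_order all_algebra all_classical all_reals all_analysis.
Set Implicit Arguments. Unset Strict Implicit. Unset Printing Implicit Defensive.
Import Order.TTheory GRing.Theory Num.Theory.
Import numFieldNormedType.Exports.
Local Open Scope classical_set_scope.
Local Open Scope ring_scope.

Section Copulas.
Variable R : realType.

Definition Icc (a b : R) : set R := `[a, b]%classic.
Definition unitI : set R := Icc 0 1.

(* bivariate copula (values outside I^2 are irrelevant) *)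
Definition copula2 (A : R -> R -> R) : Prop :=
  (forall u, unitI u -> A 0 u = 0 /\ A u 0 = 0 /\ A u 1 = u /\ A 1 u = u) /\
  (forall a1 b1 a2 b2, unitI a1 -> unitI b1 -> unitI a2 -> unitI b2 ->
     a1 <= b1 -> a2 <= b2 ->
     0 <= A b1 b2 - A a1 b2 - A b1 a2 + A a1 a2).

Definition copula3 (C : R -> R -> R -> R) : Prop :=
  (forall x y, unitI x -> unitI y ->
     C 0 x y = 0 /\ C x 0 y = 0 /\ C x y 0 = 0) /\
  (forall x, unitI x -> C x 1 1 = x /\ C 1 x 1 = x /\ C 1 1 x = x) /\
  (forall a1 b1 a2 b2 a3 b3,
     unitI a1 -> unitI b1 -> unitI a2 -> unitI b2 -> unitI a3 -> unitI b3 ->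
     a1 <= b1 -> a2 <= b2 -> a3 <= b3 ->
     0 <= C b1 b2 b3 - C a1 b2 b3 - C b1 a2 b3 - C b1 b2 a3
          + C a1 a2 b3 + C a1 b2 a3 + C b1 a2 a3 - C a1 a2 a3).

Let lam := (@lebesgue_measure R).

(* K is (a version of) the regular conditional distribution of (U1,U2)
   given U3 = t, for (U1,U2,U3) ~ C : a Markov kernel from R to R*R,
   concentrated on I^2, with C(u,v) = int_[0,v] K(t,[0,u]) dt. *)
Definition cond_kernel (C : R -> R -> R -> R)
    (K : R.-pker R ~> (R * R)%type) : Prop :=
  (forall t, K t (unitI `*` unitI) = 1%E) /\
  (forall u1 u2 v, unitI u1 -> unitI u2 -> unitI v ->
     (C u1 u2 v)%:E =
       (\int[lam]_(t in (Icc 0 v)) K t ((Icc 0 u1) `*` (Icc 0 u2)))%E).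

Definition F13 (K : R.-pker R ~> (R * R)%type) (u1 t : R) : R :=
  fine (K t ((Icc 0 u1) `*` unitI)).
Definition F23 (K : R.-pker R ~> (R * R)%type) (u2 t : R) : R :=
  fine (K t (unitI `*` (Icc 0 u2))).

Definition C3c (C : R -> R -> R -> R) : Prop :=
  copula3 C /\
  exists K : R.-pker R ~> (R * R)%type, cond_kernel C K /\
    {ae lam, forall t, unitI t ->
       continuous (fun u1 => F13 K u1 t) /\ continuous (fun u2 => F23 K u2 t)}.

(* A t is the conditional copula C^t_{12;3} (for a.e. t); we require the
   chosen version to be measurable in t so that its integral is meaningful *)
Definition cond_copula (K : R.-pker R ~> (R * R)%type)
    (A : R -> R -> R -> R) : Prop :=
  (forall s1 s2, measurable_fun unitI (fun t => A t s1 s2)) /\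
  {ae lam, forall t, unitI t ->
     copula2 (A t) /\
     forall u1 u2, unitI u1 -> unitI u2 ->
       K t ((Icc 0 u1) `*` (Icc 0 u2)) = (A t (F13 K u1 t) (F23 K u2 t))%:E}.

Definition partial_copula (A : R -> R -> R -> R) (s1 s2 : R) : R :=
  Rintegral lam unitI (fun t => A t s1 s2).

Definition is_psi (C P : R -> R -> R -> R) : Prop :=
  exists (K : R.-pker R ~> (R * R)%type) A, cond_kernel C K /\ cond_copula K A /\
    forall u1 u2 v, P u1 u2 v =
      Rintegral lam (Icc 0 v)
        (fun t => partial_copula A (F13 K u1 t) (F23 K u2 t)).

(* psi(C), chosen by description (unique on I^3 for C in C^3_c) *)
Definition psi (C : R -> R -> R -> R) : R -> R -> R -> R :=
  match pselect (exists P, is_psi C P) with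
  | left h => proj1_sig (cid h)
  | right _ => fun _ _ _ => 0
  end.

Definition dinf (C1 C2 : R -> R -> R -> R) : R :=
  sup [set r | exists u1 u2 v, unitI u1 /\ unitI u2 /\ unitI v /\
                 r = `|C1 u1 u2 v - C2 u1 u2 v|].

End Copulas.

(* Main.v *)
(* Simplified copulas are dense and psi fixes them, so continuity of psi at C
   would force psi C = C.  To approximate C, cut the cube into N^3 cells; inside
   the time slab k, run through the cells (i, j) one after the other, spending on
   each a time equal to the C-mass of (i, j, k), and during that time let
   (U1, U2) be uniform on the cell (i, j).  The resulting copula has independent
   conditional laws, agrees with C at all grid points, and hence is within 3 / N
   of C. *)

Require Import Defs.
From HB Require Import structures.
From mathcomp Require Import all_boot all_order all_algebra all_classical all_reals all_analysis.
From mathcomp Require Import measurable_realfun ring lra.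
Import Order.TTheory GRing.Theory Num.Theory.
Set Implicit Arguments.
Unset Strict Implicit.
Unset Printing Implicit Defensive.
Import numFieldNormedType.Exports.
Local Open Scope classical_set_scope.
Local Open Scope ring_scope.

(** Only one cell is active at a time because a mixture of several cells would in general have a
    dependent conditional law that changes with [t]. A single cell carries a product of two uniform
    laws, which has continuous margins and the independence copula for every [t]. The order of the
    cells within a slab is harmless: it only changes the copula strictly between two grid times. The
    delicate point is that [psi] fixes the approximants. [psi D] is chosen by description, so the
    equality has to be shown for every kernel version [K] and every version [A] of the conditional
    copula, not just for the explicit kernel. Two versions agree on a given rectangle only outside a
    null set that depends on the rectangle. Evaluating [A t] at a fixed [(s1, s2)] needs
    [t]-dependent quantiles, but here these range over a finite set, so finitely many null sets
    suffice. Nothing is known about [psi C] beyond [dinf C (psi C) <> 0]; this alone supplies the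
    bounds needed to handle the suprema. *)

Lemma unitIP (R : realType) (x : R) : unitI x <-> 0 <= x <= 1.
Proof. by rewrite /unitI /Icc /= in_itv. Qed.

Lemma unitI0 {R : realType} : unitI (0 : R).
Proof. by apply/unitIP; rewrite lexx ler01. Qed.

Lemma unitI1 {R : realType} : unitI (1 : R).
Proof. by apply/unitIP; rewrite lexx ler01. Qed.

#[local] Hint Resolve unitI0 unitI1 : core.

(** * Monotonicity and Lipschitz bounds for copulas *)

Section CopulaBounds.
Variables (R : realType) (C : R -> R -> R -> R).
Hypothesis cC : copula3 C.

(** The slab [[a, b] x I x I] has mass [b - a]. It splits into three boxes of nonnegative mass, over
    [[0, y] x [0, z]], [[y, 1] x [0, z]] and [[0, 1] x [z, 1]]; the first has mass
    [C b y z - C a y z]. *)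
Lemma copula3_lipschitz1 a b y z :
  unitI a -> unitI b -> unitI y -> unitI z -> a <= b ->
  0 <= C b y z - C a y z <= b - a.
Proof.
move=> Ia Ib Iy Iz ab; have [C0 [C1 Cbox]] := cC.
have [/andP[y0 y1] /andP[z0 z1]] := ((unitIP y).1 Iy, (unitIP z).1 Iz).
have := Cbox a b 0 y 0 z Ia Ib unitI0 Iy unitI0 Iz ab y0 z0.
have := Cbox a b y 1 0 z Ia Ib Iy unitI1 unitI0 Iz ab y1 z0.
have := Cbox a b 0 1 z 1 Ia Ib unitI0 unitI1 Iz unitI1 ab ler01 z1.
have [[? _] [? _]] := (C1 a Ia, C1 b Ib).
have [[_ [? _]] [_ [? _]]] := (C0 a z Ia Iz, C0 b z Ib Iz).
have [[_ [_ ?]] [_ [_ ?]]] := (C0 a y Ia Iy, C0 b y Ib Iy).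
have [[_ [? ?]] [_ [? ?]]] := (C0 a 1 Ia unitI1, C0 b 1 Ib unitI1).
have [[_ [? _]] [_ [? _]]] := (C0 a 0 Ia unitI0, C0 b 0 Ib unitI0).
move=> *; apply/andP; split; lra.
Qed.

Lemma copula3_lipschitz2 a b x z :
  unitI a -> unitI b -> unitI x -> unitI z -> a <= b ->
  0 <= C x b z - C x a z <= b - a.
Proof.
move=> Ia Ib Ix Iz ab; have [C0 [C1 Cbox]] := cC.
have [/andP[x0 x1] /andP[z0 z1]] := ((unitIP x).1 Ix, (unitIP z).1 Iz).
have := Cbox 0 x a b 0 z unitI0 Ix Ia Ib unitI0 Iz x0 ab z0.
have := Cbox x 1 a b 0 z Ix unitI1 Ia Ib unitI0 Iz x1 ab z0.
have := Cbox 0 1 a b z 1 unitI0 unitI1 Ia Ib Iz unitI1 ler01 ab z1.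
have [[_ [? _]] [_ [? _]]] := (C1 a Ia, C1 b Ib).
have [[? _] [? _]] := (C0 a z Ia Iz, C0 b z Ib Iz).
have [[_ [_ ?]] [_ [_ ?]]] := (C0 x a Ix Ia, C0 x b Ix Ib).
have [[? [_ _]] [? [_ _]]] := (C0 a 1 Ia unitI1, C0 b 1 Ib unitI1).
have [[_ [_ ?]] [_ [_ ?]]] := (C0 1 a unitI1 Ia, C0 1 b unitI1 Ib).
have [[? _] [? _]] := (C0 a 0 Ia unitI0, C0 b 0 Ib unitI0).
move=> *; apply/andP; split; lra.
Qed.

Lemma copula3_lipschitz3 a b x y :
  unitI a -> unitI b -> unitI x -> unitI y -> a <= b ->
  0 <= C x y b - C x y a <= b - a.
Proof.
move=> Ia Ib Ix Iy ab; have [C0 [C1 Cbox]] := cC.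
have [/andP[x0 x1] /andP[y0 y1]] := ((unitIP x).1 Ix, (unitIP y).1 Iy).
have := Cbox 0 x 0 y a b unitI0 Ix unitI0 Iy Ia Ib x0 y0 ab.
have := Cbox x 1 0 y a b Ix unitI1 unitI0 Iy Ia Ib x1 y0 ab.
have := Cbox 0 1 y 1 a b unitI0 unitI1 Iy unitI1 Ia Ib ler01 y1 ab.
have [[_ [_ ?]] [_ [_ ?]]] := (C1 a Ia, C1 b Ib).
have [[? _] [? _]] := (C0 y a Iy Ia, C0 y b Iy Ib).
have [[_ [? _]] [_ [? _]]] := (C0 x a Ix Ia, C0 x b Ix Ib).
have [[? _] [? _]] := (C0 1 a unitI1 Ia, C0 1 b unitI1 Ib).
have [[_ [? _]] [_ [? _]]] := (C0 1 a unitI1 Ia, C0 1 b unitI1 Ib).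
have [[? _] [? _]] := (C0 0 a unitI0 Ia, C0 0 b unitI0 Ib).
move=> *; apply/andP; split; lra.
Qed.

Lemma copula3_lipschitz a1 b1 a2 b2 a3 b3 :
  unitI a1 -> unitI b1 -> unitI a2 -> unitI b2 ->
  unitI a3 -> unitI b3 -> a1 <= b1 -> a2 <= b2 -> a3 <= b3 ->
  0 <= C b1 b2 b3 - C a1 a2 a3 <= (b1 - a1) + (b2 - a2) + (b3 - a3).
Proof.
move=> Ia1 Ib1 Ia2 Ib2 Ia3 Ib3 ab1 ab2 ab3.
have /andP[? ?] := copula3_lipschitz1 Ia1 Ib1 Ib2 Ib3 ab1.
have /andP[? ?] := copula3_lipschitz2 Ia2 Ib2 Ia1 Ib3 ab2.
have /andP[? ?] := copula3_lipschitz3 Ia3 Ib3 Ia1 Ia2 ab3.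
apply/andP; split; lra.
Qed.

End CopulaBounds.

(** By monotonicity both values at [x] lie between the common value at [a] and the common value at
    [b], and the Lipschitz bound limits the length of that interval. Sandwiching costs one Lipschitz
    bound instead of two. *)
Lemma copula3_close (R : realType) (C D : R -> R -> R -> R)
    a1 x1 b1 a2 x2 b2 a3 x3 b3 :
  copula3 C -> copula3 D ->
  unitI a1 -> unitI b1 -> unitI a2 -> unitI b2 ->
  unitI a3 -> unitI b3 ->
  a1 <= x1 <= b1 -> a2 <= x2 <= b2 -> a3 <= x3 <= b3 ->
  C a1 a2 a3 = D a1 a2 a3 -> C b1 b2 b3 = D b1 b2 b3 ->
  `|C x1 x2 x3 - D x1 x2 x3| <= (b1 - a1) + (b2 - a2) + (b3 - a3).
Proof.
move=> cC cD Ia1 Ib1 Ia2 Ib2 Ia3 Ib3 /andP[ax1 xb1] /andP[ax2 xb2] /andP[ax3 xb3].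
have unitI_btw (a x b : R) : unitI a -> unitI b -> a <= x -> x <= b -> unitI x.
  move=> /unitIP/andP[a0 _] /unitIP/andP[_ b1'] ax xb.
  by apply/unitIP; rewrite (le_trans a0)//= (le_trans xb).
have [Ix1 Ix2 Ix3] := And3 (unitI_btw _ _ _ Ia1 Ib1 ax1 xb1)
  (unitI_btw _ _ _ Ia2 Ib2 ax2 xb2) (unitI_btw _ _ _ Ia3 Ib3 ax3 xb3).
move=> eqa eqb; rewrite ler_norml.
have /andP[? ?] := copula3_lipschitz cC Ia1 Ix1 Ia2 Ix2 Ia3 Ix3 ax1 ax2 ax3.
have /andP[? ?] := copula3_lipschitz cD Ia1 Ix1 Ia2 Ix2 Ia3 Ix3 ax1 ax2 ax3.
have /andP[? ?] := copula3_lipschitz cC Ix1 Ib1 Ix2 Ib2 Ix3 Ib3 xb1 xb2 xb3.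
have /andP[? ?] := copula3_lipschitz cD Ix1 Ib1 Ix2 Ib2 Ix3 Ib3 xb1 xb2 xb3.
apply/andP; split; lra.
Qed.

(* The length of [a, b] below x. *)
Definition clip {R : realType} (a b x : R) : R := Num.min x b - Num.min x a.

Section Clip.
Variable R : realType.
Implicit Types a b x y : R.

Lemma clip_le a b x y : a <= b -> x <= y -> clip a b x <= clip a b y.
Proof.
by move=> ab xy; rewrite /clip /Num.min; do 4 (case: ltP => ?); lra.
Qed.

Lemma clip_left a b x : a <= b -> x <= a -> clip a b x = 0.
Proof. by move=> ab xa; rewrite /clip !min_l ?subrr// (le_trans xa). Qed.

Lemma clip_right a b x : a <= b -> b <= x -> clip a b x = b - a.
Proof. by move=> ab bx; rewrite /clip !min_r// (le_trans ab). Qed.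

Lemma sum_clip (f : nat -> R) n x :
  \sum_(0 <= i < n) clip (f i) (f i.+1) x = clip (f 0%N) (f n) x.
Proof. by rewrite (telescope_sumr (fun i => Num.min x (f i))). Qed.

Lemma continuous_clip a b : continuous (clip a b).
Proof.
move=> x; apply: cvgB; apply: continuous_min; by [exact: cvg_id|exact: cvg_cst].
Qed.

End Clip.

(** * The checkerboard copula and its distance to C *)

Section Checkerboard.
Variables (R : realType) (N : nat) (C : R -> R -> R -> R).
Hypotheses (N0 : (0 < N)%N) (cC : copula3 C).

Definition node (i : nat) : R := i%:R / N%:R.

(* Time slab k = [node k, node k.+1] is cut lexicographically in (i, j) into
   pieces whose lengths are the C-masses of the cells (i, j, k): brk k i j is
   the left end of piece (k, i, j). *)
Definition brk (k i j : nat) : R :=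
  node k + (C (node i) 1 (node k.+1) - C (node i) 1 (node k))
  + (C (node i.+1) (node j) (node k.+1) - C (node i.+1) (node j) (node k)
     - (C (node i) (node j) (node k.+1) - C (node i) (node j) (node k))).

(** Distribution function of the uniform law on [[node i, node i.+1]]. *)
Definition cell_cdf (i : nat) (x : R) : R := N%:R * clip (node i) (node i.+1) x.

(** The [clip] factor is the time spent in piece [(k, i, j)] up to [v]; the product is the law of
    [(U1, U2)] during that time. *)
Definition checkerboard (u1 u2 v : R) : R :=
  \sum_(0 <= k < N) \sum_(0 <= i < N) \sum_(0 <= j < N)
    clip (brk k i j) (brk k i j.+1) v * (cell_cdf i u1 * cell_cdf j u2).

Let Npos : 0 < N%:R :> R. Proof. by rewrite ltr0n. Qed.

Lemma node0 : node 0 = 0. Proof. by rewrite /node mul0r. Qed.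

Lemma nodeN : node N = 1.
Proof. by rewrite /node divff// gt_eqF. Qed.

Lemma le_node i j : (i <= j)%N -> node i <= node j.
Proof. by move=> ij; rewrite ler_pM2r ?invr_gt0// ler_nat. Qed.

Lemma nodeS i : node i.+1 - node i = N%:R^-1.
Proof. by rewrite /node -mulrBl -natr1 addrAC subrr add0r mul1r. Qed.

Lemma unitI_node i : (i <= N)%N -> unitI (node i).
Proof.
move=> iN; apply/unitIP; rewrite divr_ge0//=.
by rewrite ler_pdivrMr// mul1r ler_nat.
Qed.

Hint Resolve unitI_node : core.

Lemma le_brk k i j : (k < N)%N -> (i < N)%N -> (j < N)%N ->
  brk k i j <= brk k i j.+1.
Proof.
move=> kN iN jN; have [_ [_ box]] := cC.
have := box (node i) (node i.+1) (node j) (node j.+1) (node k) (node k.+1).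
move=> /(_ (unitI_node (ltnW iN)) (unitI_node iN) (unitI_node (ltnW jN))
  (unitI_node jN) (unitI_node (ltnW kN)) (unitI_node kN)).
move=> /(_ (le_node (leqnSn _)) (le_node (leqnSn _)) (le_node (leqnSn _))).
by rewrite /brk; lra.
Qed.

Lemma brk_col0 k i : (k < N)%N -> (i < N)%N ->
  brk k i 0 = node k + (C (node i) 1 (node k.+1) - C (node i) 1 (node k)).
Proof.
move=> kN iN; have [C0 _] := cC; rewrite /brk node0.
have C0' x z : unitI x -> unitI z -> C x 0 z = 0.
  by move=> Ix Iz; case: (C0 x z Ix Iz) => _ [].
by rewrite !C0' ?subrr ?addr0//; apply: unitI_node => //; exact: ltnW.
Qed.

(** The right side is that of [brk_col0] at [i.+1]: each row of pieces ends where the next begins,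
    so sums telescoping in [j] chain into sums telescoping in [i]. *)
Lemma brk_colN k i : (k < N)%N -> (i < N)%N ->
  brk k i N = node k + (C (node i.+1) 1 (node k.+1) - C (node i.+1) 1 (node k)).
Proof. by move=> kN iN; rewrite /brk nodeN; ring. Qed.

Lemma brk_row0 k : (k < N)%N ->
  node k + (C (node 0) 1 (node k.+1) - C (node 0) 1 (node k)) = node k.
Proof.
move=> kN; have [C0 _] := cC; rewrite node0.
have C0' z : unitI z -> C 0 1 z = 0 by move=> Iz; case: (C0 1 z unitI1 Iz).
by rewrite !C0' ?subrr ?addr0//; apply: unitI_node => //; exact: ltnW.
Qed.

Lemma brk_rowN k : (k < N)%N ->
  node k + (C (node N) 1 (node k.+1) - C (node N) 1 (node k)) = node k.+1.
Proof.
move=> kN; have [_ [C1 _]] := cC; rewrite nodeN.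
have C1' z : unitI z -> C 1 1 z = z by move=> Iz; case: (C1 z Iz) => _ [].
by rewrite !C1'; [ring|apply: unitI_node; exact: ltnW|exact: unitI_node].
Qed.

Lemma sum_brk (V : zmodType) (f : R -> V) k : (k < N)%N ->
  \sum_(0 <= i < N) \sum_(0 <= j < N) (f (brk k i j.+1) - f (brk k i j))
  = f (node k.+1) - f (node k).
Proof.
move=> kN.
pose g i := node k + (C (node i) 1 (node k.+1) - C (node i) 1 (node k)).
transitivity (f (g N) - f (g 0%N)); last by rewrite /g brk_rowN// brk_row0.
rewrite -(telescope_sumr (f \o g))//=.
apply: eq_big_nat => i /andP[_ iN].
by rewrite (telescope_sumr (fun j => f (brk k i j)))// brk_col0// brk_colN.
Qed.

(** The pieces tile [[0, 1]] end to end. Taking [f] to be [Num.min u] yields the third margin;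
    taking it to be a step function of the left end yields the partition of [[0, 1)]. *)
Lemma sum_brk3 (V : zmodType) (f : R -> V) :
  \sum_(0 <= k < N) \sum_(0 <= i < N) \sum_(0 <= j < N)
     (f (brk k i j.+1) - f (brk k i j)) = f 1 - f 0.
Proof.
rewrite -[in f 1]nodeN -[in f 0]node0 -(telescope_sumr (f \o node))//=.
by apply: eq_big_nat => k /andP[_ kN]; rewrite sum_brk.
Qed.

Lemma sum_telescope2 (f : nat -> nat -> R) m n :
  \sum_(0 <= k < m) \sum_(0 <= i < n)
     (f k.+1 i.+1 - f k.+1 i - (f k i.+1 - f k i))
  = f m n - f m 0%N - (f 0%N n - f 0%N 0%N).
Proof.
rewrite -(telescope_sumr (fun k => f k n - f k 0%N))//=.
apply: eq_bigr => k _.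
by rewrite sumrB !telescope_sumr//; ring.
Qed.

Definition mass k i j := brk k i j.+1 - brk k i j.

Lemma sum_mass a b c : (a <= N)%N -> (b <= N)%N -> (c <= N)%N ->
  \sum_(0 <= k < c) \sum_(0 <= i < a) \sum_(0 <= j < b) mass k i j
  = C (node a) (node b) (node c).
Proof.
move=> aN bN cN; have [C0 _] := cC.
(* The subtracted term vanishes, but it is what the inner sum over [j] leaves at [node 0]. *)
pose f k i := C (node i) (node b) (node k) - C (node i) 0 (node k).
transitivity (f c a - f c 0%N - (f 0%N a - f 0%N 0%N)); last first.
  rewrite /f node0.
  have [[? [? _]] [? [? _]]] := (C0 _ _ (unitI_node bN) (unitI_node cN),
    C0 _ _ (unitI_node aN) (unitI_node cN)).
  have [_ [_ ?]] := C0 _ _ (unitI_node aN) (unitI_node bN).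
  have [? [? ?]] := C0 _ _ (unitI_node bN) (@unitI0 R).
  have [? [? ?]] := C0 _ _ (@unitI0 R) (unitI_node cN).
  have [? [? ?]] := C0 _ _ (@unitI0 R) (unitI_node bN).
  have [? [? ?]] := C0 _ _ (unitI_node aN) (@unitI0 R).
  by have [? [? ?]] := C0 _ _ (@unitI0 R) (@unitI0 R); lra.
rewrite -sum_telescope2; apply: eq_bigr => k _; apply: eq_bigr => i _.
rewrite (telescope_sumr (fun j => brk k i j))// /brk /f node0; ring.
Qed.

Lemma sum_mass_row i : (i < N)%N ->
  \sum_(0 <= k < N) \sum_(0 <= j < N) mass k i j = N%:R^-1.
Proof.
move=> iN; have [C0 [C1 _]] := cC.
pose f k j := C (node i.+1) (node j) (node k) - C (node i) (node j) (node k).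
transitivity (f N N - f N 0%N - (f 0%N N - f 0%N 0%N)); last first.
  rewrite /f node0 nodeN -(nodeS i).
  have [Ii Ii1] := (unitI_node (ltnW iN), unitI_node iN).
  have [[? _] [? _]] := (C1 _ Ii, C1 _ Ii1).
  have [[_ [? ?]] [_ [? ?]]] := (C0 _ _ Ii (@unitI1 R), C0 _ _ Ii1 (@unitI1 R)).
  by have [[_ [? _]] [_ [? _]]] := (C0 _ _ Ii (@unitI0 R), C0 _ _ Ii1 (@unitI0 R)); lra.
rewrite -sum_telescope2; apply: eq_bigr => k _; apply: eq_bigr => j _.
by rewrite /mass /brk /f; ring.
Qed.

Lemma sum_mass_col j : (j < N)%N ->
  \sum_(0 <= k < N) \sum_(0 <= i < N) mass k i j = N%:R^-1.
Proof.
move=> jN; have [C0 [C1 _]] := cC.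
pose f k i := C (node i) (node j.+1) (node k) - C (node i) (node j) (node k).
transitivity (f N N - f N 0%N - (f 0%N N - f 0%N 0%N)); last first.
  rewrite /f node0 nodeN -(nodeS j).
  have [Ij Ij1] := (unitI_node (ltnW jN), unitI_node jN).
  have [[_ [? _]] [_ [? _]]] := (C1 _ Ij, C1 _ Ij1).
  have [[? _] [? _]] := (C0 _ _ Ij (@unitI1 R), C0 _ _ Ij1 (@unitI1 R)).
  have [[_ [_ ?]] [_ [_ ?]]] := (C0 _ _ (@unitI1 R) Ij, C0 _ _ (@unitI1 R) Ij1).
  by have [[? _] [? _]] := (C0 _ _ Ij (@unitI0 R), C0 _ _ Ij1 (@unitI0 R)); lra.
rewrite -sum_telescope2; apply: eq_bigr => k _; apply: eq_bigr => i _.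
by rewrite /mass /brk /f; ring.
Qed.

(** [brk k i j - node k] is the mass, within slab [k], of the cells preceding [(i, j)]: the full
    rows below [i] and the part of row [i] below [j]. Dually, [brk_le_node] measures what
    remains. *)
Lemma node_le_brk k i j : (k < N)%N -> (i < N)%N -> (j <= N)%N ->
  node k <= brk k i j.
Proof.
move=> kN iN jN; have [C0 [_ box]] := cC.
have [Ik Ik1] := (unitI_node (ltnW kN), unitI_node kN).
have [Ii Ii1] := (unitI_node (ltnW iN), unitI_node iN).
have /andP[+ _] := copula3_lipschitz3 cC Ik Ik1 Ii unitI1 (le_node (leqnSn k)).
have Ij := unitI_node jN; have /andP[j0 _] := (unitIP _).1 Ij.
have := box _ _ _ _ _ _ Ii Ii1 unitI0 Ij Ik Ik1
  (le_node (leqnSn i)) j0 (le_node (leqnSn k)).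
have [[_ [? _]] [_ [? _]]] := (C0 _ _ Ii Ik, C0 _ _ Ii1 Ik).
have [[_ [? _]] [_ [? _]]] := (C0 _ _ Ii Ik1, C0 _ _ Ii1 Ik1).
by rewrite /brk; lra.
Qed.

Lemma brk_le_node k i j : (k < N)%N -> (i < N)%N -> (j <= N)%N ->
  brk k i j <= node k.+1.
Proof.
move=> kN iN jN; have [_ [_ box]] := cC.
have [Ik Ik1] := (unitI_node (ltnW kN), unitI_node kN).
have [Ii Ii1] := (unitI_node (ltnW iN), unitI_node iN).
have /andP[_ +] := copula3_lipschitz3 cC Ik Ik1 Ii1 unitI1 (le_node (leqnSn k)).
have Ij := unitI_node jN; have /andP[_ j1] := (unitIP _).1 Ij.
have := box _ _ _ _ _ _ Ii Ii1 Ij unitI1 Ik Ik1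
  (le_node (leqnSn i)) j1 (le_node (leqnSn k)).
by rewrite /brk; lra.
Qed.

Lemma unitI_brk k i j : (k < N)%N -> (i < N)%N -> (j <= N)%N ->
  unitI (brk k i j).
Proof.
move=> kN iN jN; apply/unitIP/andP; split.
  by apply: le_trans (node_le_brk kN iN jN); rewrite -node0 le_node.
by apply: le_trans (brk_le_node kN iN jN) _; rewrite -nodeN le_node.
Qed.

(** A piece never leaves its slab, so at a grid time it is either finished or not yet begun. This is
    the source of the agreement with [C] at grid points. *)
Lemma clip_brk_node k i j c : (k < N)%N -> (i < N)%N -> (j < N)%N ->
  clip (brk k i j) (brk k i j.+1) (node c) = (k < c)%:R * mass k i j.
Proof.
move=> kN iN jN; have bb := le_brk kN iN jN; case: ltnP => kc.
  rewrite mul1r clip_right// (le_trans (brk_le_node _ _ _))//.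
  exact: le_node.
rewrite mul0r clip_left// (le_trans (le_node kc))//.
by rewrite node_le_brk// ltnW.
Qed.

Lemma clip_brk1 k i j : (k < N)%N -> (i < N)%N -> (j < N)%N ->
  clip (brk k i j) (brk k i j.+1) 1 = mass k i j.
Proof. by move=> kN iN jN; have := clip_brk_node N kN iN jN; rewrite nodeN kN mul1r. Qed.

Lemma cell_cdf_le i x y : x <= y -> cell_cdf i x <= cell_cdf i y.
Proof. by move=> xy; rewrite ler_pM2l// clip_le// le_node. Qed.

Lemma cell_cdf_node i a : cell_cdf i (node a) = (i < a)%:R.
Proof.
rewrite /cell_cdf; case: ltnP => ia.
  by rewrite clip_right ?le_node// nodeS divff// gt_eqF.
by rewrite clip_left ?le_node// mulr0.
Qed.

Lemma cell_cdf0 i : cell_cdf i 0 = 0.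
Proof. by have := cell_cdf_node i 0; rewrite node0. Qed.

Lemma cell_cdf1 i : (i < N)%N -> cell_cdf i 1 = 1.
Proof. by move=> iN; have := cell_cdf_node i N; rewrite nodeN iN. Qed.

Lemma sum_cell_cdf x : unitI x -> \sum_(0 <= i < N) cell_cdf i x = N%:R * x.
Proof.
move=> /unitIP/andP[x0 x1]; rewrite -big_distrr/= sum_clip node0 nodeN /clip.
by rewrite min_l// min_r// subr0.
Qed.

Lemma sum_nat_ltn (V : nzRingType) (f : nat -> V) n : (n <= N)%N ->
  \sum_(0 <= i < N) (i < n)%:R * f i = \sum_(0 <= i < n) f i.
Proof.
move=> nN; rewrite (@big_nat_widen _ _ _ 0 n N)//= [RHS]big_mkcond/=.
by apply: eq_bigr => i _; case: ifP => _; rewrite ?mul1r ?mul0r.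
Qed.

Lemma checkerboard_node a b c : (a <= N)%N -> (b <= N)%N -> (c <= N)%N ->
  checkerboard (node a) (node b) (node c) = C (node a) (node b) (node c).
Proof.
move=> aN bN cN; rewrite -sum_mass// -sum_nat_ltn//.
apply: eq_big_nat => k /andP[_ kN].
rewrite -[in RHS]sum_nat_ltn// big_distrr/=; apply: eq_big_nat => i /andP[_ iN].
rewrite -[in RHS]sum_nat_ltn// !big_distrr/=; apply: eq_big_nat => j /andP[_ jN].
by rewrite clip_brk_node// !cell_cdf_node; ring.
Qed.

Lemma copula3_checkerboard : copula3 checkerboard.
Proof.
split; [|split].
- move=> x y Ix Iy; rewrite /checkerboard; split; [|split].
  + by do 3 (apply: big1 => ? _); rewrite cell_cdf0 mul0r mulr0.
  + by do 3 (apply: big1 => ? _); rewrite cell_cdf0 !mulr0.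
  + rewrite big_nat_cond big1// => k /andP[/andP[_ kN] _].
    rewrite big_nat_cond big1// => i /andP[/andP[_ iN] _].
    rewrite big_nat_cond big1// => j /andP[/andP[_ jN] _].
    rewrite clip_left ?mul0r// ?le_brk//.
    by have /unitIP/andP[] := unitI_brk kN iN (ltnW jN).
- move=> u Iu; rewrite /checkerboard; split; [|split].
  (* Row [i] is active for total time [1 / N], so the margin is the average of the [cell_cdf i u],
     whose sum is [N * u]. *)
  + rewrite exchange_big/= -[RHS](@mulKf _ N%:R) ?gt_eqF// -sum_cell_cdf//.
    rewrite big_distrr/=; apply: eq_big_nat => i /andP[_ iN].
    rewrite -(sum_mass_row iN) big_distrl/=; apply: eq_big_nat => k /andP[_ kN].
    rewrite big_distrl/=; apply: eq_big_nat => j /andP[_ jN].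
    by rewrite clip_brk1// (cell_cdf1 jN) mulr1.
  + under eq_bigr do rewrite exchange_big/=.
    rewrite exchange_big/= -[RHS](@mulKf _ N%:R) ?gt_eqF// -sum_cell_cdf//.
    rewrite big_distrr/=; apply: eq_big_nat => j /andP[_ jN].
    rewrite -(sum_mass_col jN) big_distrl/=; apply: eq_big_nat => k /andP[_ kN].
    rewrite big_distrl/=; apply: eq_big_nat => i /andP[_ iN].
    by rewrite clip_brk1// (cell_cdf1 iN) mul1r.
  (* With both cell factors equal to 1, the time spent in all pieces up to [u] telescopes. *)
  + have /unitIP/andP[u0 u1] := Iu.
    transitivity (Num.min u 1 - Num.min u 0).
      rewrite -(sum_brk3 (Num.min u)).
      apply: eq_big_nat => k /andP[_ kN]; apply: eq_big_nat => i /andP[_ iN].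
      apply: eq_big_nat => j /andP[_ jN].
      by rewrite !cell_cdf1// !mulr1.
    by rewrite min_l// min_r// subr0.
- move=> a1 b1 a2 b2 a3 b3 _ _ _ _ _ _ ab1 ab2 ab3.
  rewrite /checkerboard -!sumrB -!big_split/= -!sumrB.
  rewrite big_nat_cond; apply: sumr_ge0 => k /andP[/andP[_ kN] _].
  rewrite -!sumrB -!big_split/= -!sumrB big_nat_cond;
  apply: sumr_ge0 => i /andP[/andP[_ iN] _].
  rewrite -!sumrB -!big_split/= -!sumrB big_nat_cond;
  apply: sumr_ge0 => j /andP[/andP[_ jN] _].
  rewrite [leRHS](_ : _ =
      (clip (brk k i j) (brk k i j.+1) b3 - clip (brk k i j) (brk k i j.+1) a3)
      * ((cell_cdf i b1 - cell_cdf i a1) * (cell_cdf j b2 - cell_cdf j a2))).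
    by rewrite !mulr_ge0 ?subr_ge0 ?cell_cdf_le// clip_le// le_brk.
  by ring.
Qed.

Lemma node_cover x : unitI x ->
  exists2 i, (i < N)%N & node i <= x <= node i.+1.
Proof.
move=> /unitIP/andP[x0 x1].
have [n [nN nx]] : exists n, (n <= N)%N /\ x <= node n.
  by exists N; rewrite nodeN.
elim: n => [|n IH] in nN nx *.
  exists 0%N => //; rewrite node0 x0/= (le_trans nx)//; exact: le_node.
have [xn|/ltW xn] := leP x (node n); last by exists n => //; rewrite xn.
exact: IH (ltnW nN) xn.
Qed.

Lemma checkerboard_close u1 u2 v : unitI u1 -> unitI u2 -> unitI v ->
  `|C u1 u2 v - checkerboard u1 u2 v| <= 3 / N%:R.
Proof.
move=> /node_cover[a aN ua] /node_cover[b bN ub] /node_cover[c cN uc].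
have [Ia Ib Ic] := And3 (unitI_node (ltnW aN)) (unitI_node (ltnW bN))
  (unitI_node (ltnW cN)).
have := copula3_close cC copula3_checkerboard Ia (unitI_node aN) Ib
  (unitI_node bN) Ic (unitI_node cN) ua ub uc.
rewrite !checkerboard_node//; try exact: ltnW.
by move=> /(_ erefl erefl) /le_trans; apply; rewrite !nodeS; lra.
Qed.

End Checkerboard.

(** * Functions determined almost everywhere by their prefix integrals *)

Lemma bounded_integrable_Icc0 (R : realType) (f : R -> R) v :
  measurable_fun [set: R] f -> (forall t, 0 <= f t <= 1) ->
  (@lebesgue_measure R).-integrable (Icc 0 v) (EFin \o f).
Proof.
move=> mf f01; apply: measurable_bounded_integrable.
- exact: measurable_itv.
- by rewrite /= lebesgue_measure_itv/=; case: ifP => _; rewrite ?ltry// -EFinB ltry.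
- exact: measurable_funTS.
- exists 1; split => // r r1 x _ /=; have /andP[f0 f1] := f01 x.
  by rewrite ger0_norm// (le_trans f1)// ltW.
Qed.

(** By Lebesgue differentiation each function is almost everywhere the derivative of its prefix
    integral. *)
Lemma ae_eq_prefix_integral (R : realType) (f g : R -> R) :
  measurable_fun [set: R] f -> measurable_fun [set: R] g ->
  (forall t, 0 <= f t <= 1) -> (forall t, 0 <= g t <= 1) ->
  (forall v, unitI v ->
     Rintegral (@lebesgue_measure R) (Icc 0 v) f
     = Rintegral (@lebesgue_measure R) (Icc 0 v) g) ->
  {ae @lebesgue_measure R, forall t, unitI t -> f t = g t}.
Proof.
move=> mf mg f01 g01 fg.
have diff (h : R -> R) : measurable_fun [set: R] h -> (forall t, 0 <= h t <= 1) ->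
    {ae @lebesgue_measure R, forall t, unitI t -> 0 < t ->
      derive1 (fun x : R => Rintegral (@lebesgue_measure R) (Icc 0 x)
        (h \_ (Icc 0 1))) t = h t}.
  move=> mh h01.
  have ih := bounded_integrable_Icc0 1 mh h01.
  have mI : measurable (Icc 0 1 : set (measurableTypeR R)) by exact: measurable_itv.
  have ihT : (@lebesgue_measure R).-integrable setT (EFin \o (h \_ (Icc 0 1))).
    have := (@integrable_mkcond _ (measurableTypeR R) R lebesgue_measure _
      (EFin \o h) mI).1 ih.
    by rewrite restrict_EFin.
  have loc := integrable_locally mI ih.
  have := @FTC1 R (h \_ (Icc 0 1)) (BLeft 0) _ loc.
  have iy y : (@lebesgue_measure R).-integrable [set` Interval (BLeft 0) (BRight y)]
      (EFin \o (h \_ (Icc 0 1))).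
    by apply: integrableS ihT => //; exact: measurable_itv.
  move=> /(_ iy).
  apply: filterS; first exact: (ae_filter_ringOfSetsType lebesgue_measure).
  move=> t Ht It t0.
  have [|_ ->] := Ht; first by rewrite lte_fin.
  by rewrite patchE mem_set.
(* Cutting off to [[0, 1]] makes the prefix integrals agree on the whole line, so their derivatives
   agree as functions, including at the endpoint 1. *)
have FG : (fun x : R => Rintegral (@lebesgue_measure R) (Icc 0 x) (f \_ (Icc 0 1)))
   = (fun x : R => Rintegral (@lebesgue_measure R) (Icc 0 x) (g \_ (Icc 0 1))).
  apply/funext => x; rewrite -!Rintegral_mkcondr.
  have [x0|x0] := ltP x 0.
    have -> : Icc 0 x = set0 by rewrite /Icc set_itv_ge// bnd_simp -ltNge.
    by rewrite set0I !Rintegral_set0.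
  have -> : Icc 0 x `&` Icc 0 1 = Icc 0 (Num.min x 1).
    rewrite /Icc; apply/seteqP; split => y /=; rewrite !in_itv/= le_min.
      by move=> [/andP[-> ->] /andP[_ ->]].
    by move=> /and3P[-> -> ->].
  apply: fg; apply/unitIP; rewrite le_min x0 ler01/= ge_min lexx orbT//.
have := diff f mf f01; have := diff g mg g01; rewrite FG => dg df.
(* The differentiation theorem covers only points strictly to the right of the lower limit 0. *)
have : {ae @lebesgue_measure R, forall t, t != 0}.
  exists [set 0]; split => //; first by rewrite lebesgue_measure_set1.
  by move=> t /= /negP; rewrite negbK => /eqP.
apply: (@filterS3 _ _ (ae_filter_ringOfSetsType lebesgue_measure)) dg df.
move=> t gt ft t0 It.
have tpos : 0 < t by rewrite lt_neqAle eq_sym t0; have /unitIP/andP[] := It.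
by rewrite -gt// ft.
Qed.

(** * Kernels that are piecewise constant in time *)

Section StepKernel.
Context d (Y : measurableType d) (R : realType) (I : finType).
Variables (m0 : I) (S : I -> set R) (P : I -> probability Y R).

Definition step_index (t : R) : I := odflt m0 [pick m | `[< S m t >]].

(** Carrying [mS] and [dS] as arguments lets the kernel structures, whose proofs rely on them, be
    inferred from the term itself. *)
Definition step_kernel
    (mS : forall m, measurable (S m))
    (dS : forall m m' t, S m t -> S m' t -> m = m') (t : R) :
  {measure set Y -> \bar R} := P (step_index t).

Hypothesis mS : forall m, measurable (S m).
Hypothesis dS : forall m m' t, S m t -> S m' t -> m = m'.

Lemma step_indexE m t : S m t -> step_index t = m.
Proof.
move=> Smt; rewrite /step_index; case: pickP => [m' /asboolP Sm't|/(_ m)].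
  exact: dS Sm't Smt.
by move/asboolP.
Qed.

Lemma step_index_preimage m :
  step_index @^-1` [set m] =
  S m `|` (if m == m0 then ~` \bigcup_(i in [set: I]) S i else set0).
Proof.
apply/seteqP; split => t /=.
  rewrite /step_index; case: pickP => [m' /asboolP Sm't <-|nS <-]; first by left.
  by right; rewrite eqxx => -[i _ Sit]; have := nS i; move/asboolP.
case=> [|]; first exact: step_indexE.
case: eqP => // -> nS; rewrite /step_index; case: pickP => //= m' /asboolP Sm't.
by exfalso; apply: nS; exists m'.
Qed.

(** Since [I] is finite, singletons generate all its subsets; hence [f \o step_index] is measurable
    for every [f]. *)
Lemma measurable_step_index (A : set I) : measurable (step_index @^-1` A).
Proof.
have -> : step_index @^-1` A = \bigcup_(m in A) step_index @^-1` [set m].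
  by apply/seteqP; split => t /=; [exists (step_index t)|case=> m Am /= ->].
apply: fin_bigcup_measurable; first exact: finite_finset.
move=> m _; rewrite step_index_preimage; apply: measurableU => //.
case: ifP => _ //; apply: measurableC; apply: fin_bigcup_measurable => //.
Qed.

Lemma measurable_step_fun d' (T : sigmaRingType d') (f : I -> T) :
  measurable_fun [set: R] (f \o step_index).
Proof.
move=> _ B _; rewrite setTI comp_preimage.
exact: measurable_step_index.
Qed.

Let measurable_step_kernel U : measurable U ->
  measurable_fun [set: R] (step_kernel mS dS ^~ U).
Proof. by move=> _; exact: (measurable_step_fun (fun m => P m U)). Qed.

HB.instance Definition _ :=
  isKernel.Build _ _ _ _ _ (step_kernel mS dS) measurable_step_kernel.

Let step_kernel_prob t : step_kernel mS dS t [set: Y] = 1%E.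
Proof. exact: probability_setT. Qed.

HB.instance Definition _ :=
  Kernel_isProbability.Build _ _ _ _ _ (step_kernel mS dS) step_kernel_prob.

End StepKernel.

(** * The uniform law on a cell side *)

Section UniformCell.
Variable R : realType.

Definition borel_id : measurableTypeR R -> R := idfun.

HB.instance Definition _ :=
  @isMeasurableFun.Build _ _ _ _ borel_id (@measurable_id _ _ setT).

(* uniform_prob lives on the type alias measurableTypeR R, whereas kernels to
   R * R use the measurable structure on R itself. *)
Definition uniform (a b : R) (ab : a < b) : probability R R :=
  distribution (uniform_prob ab) borel_id.

Lemma uniform_Icc0 (a b : R) (ab : a < b) x : 0 <= a ->
  uniform ab (Icc 0 x) = ((b - a)^-1 * clip a b x)%:E.
Proof.
move=> a0; rewrite /uniform/= /distribution/= /pushforward/= preimage_id.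
rewrite /uniform_prob integral_uniform_pdf.
have -> : Icc 0 x `&` `[a, b] = `[a, Num.min x b]%classic.
  rewrite /Icc; apply/seteqP; split => y /=; rewrite !in_itv/= le_min.
    by move=> [/andP[_ ->] /andP[-> ->]].
  by move=> /and3P[ay -> ->]; rewrite ay (le_trans a0 ay).
rewrite (eq_integral (cst (b - a)^-1%:E)); last first.
  move=> y; rewrite inE/= in_itv/= le_min /uniform_pdf => /and3P[-> _ ->] //.
rewrite integral_cst//= lebesgue_measure_itv/= lte_fin /clip.
case: ltP => [axb|xba].
  have ax : a < x by rewrite (lt_le_trans axb)// ge_min lexx.
  by rewrite -EFinB -EFinM (min_r (ltW ax)).
have xa : x <= a.
  by move: xba; rewrite ge_min => /orP[//|]; rewrite leNgt ab.
by rewrite mule0 !min_l ?subrr ?mulr0// (le_trans xa)// ltW.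
Qed.

End UniformCell.

(** * The conditional kernel of the checkerboard copula *)

Section CheckerboardKernel.
Variables (R : realType) (N : nat) (C : R -> R -> R -> R).
Hypotheses (N0 : (0 < N)%N) (cC : copula3 C).

Let cell := ('I_N * 'I_N * 'I_N)%type.

Lemma node_lt i : node R N i < node R N i.+1.
Proof. by rewrite -subr_gt0 nodeS invr_gt0 ltr0n. Qed.

(** Half-open, so that consecutive pieces are disjoint and a cell of mass zero gets an empty
    piece. *)
Definition piece (m : cell) : set R :=
  `[brk N C m.1.1 m.1.2 m.2, brk N C m.1.1 m.1.2 m.2.+1[%classic.

Definition cell_prob (m : cell) : probability (R * R)%type R :=
  (uniform (node_lt m.1.2) \x uniform (node_lt m.2))%E.

Lemma sum_cells (V : nmodType) (F : nat -> nat -> nat -> V) :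
  \sum_(0 <= k < N) \sum_(0 <= i < N) \sum_(0 <= j < N) F k i j
  = \sum_(m : cell) F m.1.1 m.1.2 m.2.
Proof.
rewrite big_mkord -(pair_bigA _ (fun (p : 'I_N * 'I_N) (j : 'I_N) => F p.1 p.2 j))/=.
rewrite -(pair_bigA _ (fun (k i : 'I_N) => \sum_(j < N) F k i j))/=.
apply: eq_bigr => k _; rewrite big_mkord; apply: eq_bigr => i _.
by rewrite big_mkord.
Qed.

(** The indicator of [[a, b[] at [t] is a difference of step functions of its ends, so [sum_brk3]
    applies. One identity then gives both covering (the sum is nonzero) and disjointness (the sum is
    at most 1). *)
Lemma sum_indic_piece t : \sum_(m : cell) \1_(piece m) t = (0 <= t < 1)%R%:R :> R.
Proof.
transitivity (\sum_(m : cell) ((- (brk N C m.1.1 m.1.2 m.2.+1 <= t)%R%:R)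
    - (- (brk N C m.1.1 m.1.2 m.2 <= t)%R%:R)) : R).
  apply: eq_bigr => -[[k i] j] _ /=.
  have := le_brk N0 cC (ltn_ord k) (ltn_ord i) (ltn_ord j).
  set a := brk N C k i j; set b := brk N C k i j.+1 => ab.
  rewrite indicE /piece/= mem_setE in_itv/= -/a -/b.
  have [bt|tb] := leP b t; rewrite ?andbF ?(le_trans ab bt)/=.
    by rewrite opprK addNr.
  by rewrite andbT oppr0 opprK add0r.
rewrite -(sum_cells (fun k i j => - (brk N C k i j.+1 <= t)%R%:R
  - (- (brk N C k i j <= t)%R%:R))).
rewrite (sum_brk3 N0 cC (fun x => - (x <= t)%R%:R)).
have [t1|t1] := leP 1 t; rewrite ?andbF ?andbT.
  by rewrite (le_trans ler01 t1) opprK addNr.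
by rewrite oppr0 opprK add0r.
Qed.

Lemma piece_cover t : 0 <= t < 1 -> exists m, piece m t.
Proof.
move=> t01; apply: contrapT => npiece.
have := sum_indic_piece t; rewrite t01 big1; first by move/esym/eqP; rewrite oner_eq0.
move=> m _; rewrite indicE memNset//= => pmt; apply: npiece; by exists m.
Qed.

Lemma piece_disjoint m m' t : piece m t -> piece m' t -> m = m'.
Proof.
move=> pm pm'; apply/eqP/negPn/negP => mm'.
have : \sum_(m : cell) \1_(piece m) t <= 1 :> R.
  by rewrite sum_indic_piece lern1 leq_b1.
rewrite (bigD1 m)//= (bigD1 m')/=; last by rewrite eq_sym.
rewrite !indicE !mem_set// -[leRHS]addr0 lerD2l leNgt => /negP; apply.
by rewrite (lt_le_trans ltr01)// lerDl sumr_ge0.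
Qed.

Lemma measurable_piece m : measurable (piece m).
Proof. exact: measurable_itv. Qed.

Definition checkerboard_index : R -> cell :=
  step_index (Ordinal N0, Ordinal N0, Ordinal N0) piece.

Definition checkerboard_kernel : R.-pker R ~> (R * R)%type :=
  step_kernel (Ordinal N0, Ordinal N0, Ordinal N0) cell_prob
    measurable_piece piece_disjoint.

Let row t : nat := (checkerboard_index t).1.2.
Let col t : nat := (checkerboard_index t).2.

Lemma uniform_node_Icc0 i x :
  uniform (node_lt i) (Icc 0 x) = (cell_cdf N i x)%:E.
Proof.
rewrite uniform_Icc0; last by rewrite -(node0 R N) le_node.
by rewrite nodeS invrK.
Qed.

Lemma checkerboard_kernel_rect u1 u2 t :
  checkerboard_kernel t (Icc 0 u1 `*` Icc 0 u2)
  = (cell_cdf N (row t) u1 * cell_cdf N (col t) u2)%:E.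
Proof.
rewrite [LHS](_ : _ = cell_prob (checkerboard_index t) (Icc 0 u1 `*` Icc 0 u2))//.
rewrite [LHS]product_measure1E; try exact: measurable_itv.
by rewrite EFinM -!uniform_node_Icc0.
Qed.

Lemma F13_checkerboard u t : F13 checkerboard_kernel u t = cell_cdf N (row t) u.
Proof.
rewrite /F13 checkerboard_kernel_rect/= (cell_cdf1 R N0) ?mulr1//.
exact: ltn_ord.
Qed.

Lemma F23_checkerboard u t : F23 checkerboard_kernel u t = cell_cdf N (col t) u.
Proof.
rewrite /F23 checkerboard_kernel_rect/= (cell_cdf1 R N0) ?mul1r//.
exact: ltn_ord.
Qed.

Lemma checkerboard_kernel_sum u1 u2 t : 0 <= t < 1 ->
  checkerboard_kernel t (Icc 0 u1 `*` Icc 0 u2)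
  = (\sum_(m : cell) ((cell_cdf N m.1.2 u1 * cell_cdf N m.2 u2)%:E
                      * (\1_(piece m) t)%:E))%E.
Proof.
move=> /piece_cover[m pmt]; rewrite checkerboard_kernel_rect.
have -> : row t = m.1.2.
  by rewrite /row /checkerboard_index (step_indexE _ piece_disjoint pmt).
have -> : col t = m.2.
  by rewrite /col /checkerboard_index (step_indexE _ piece_disjoint pmt).
rewrite (bigD1 m)//= big1 ?adde0; first by rewrite indicE mem_set// mule1.
move=> m' m'm; rewrite indicE memNset ?mule0// => pm't.
by move: m'm; rewrite (piece_disjoint pm't pmt) eqxx.
Qed.

Lemma lebesgue_piece m v : 0 <= v ->
  lebesgue_measure (piece m `&` `[0, v[%classic)
  = (clip (brk N C m.1.1 m.1.2 m.2) (brk N C m.1.1 m.1.2 m.2.+1) v)%:E.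
Proof.
move=> v0; rewrite /piece; case: m => [[k i] j] /=.
have := le_brk N0 cC (ltn_ord k) (ltn_ord i) (ltn_ord j).
have /unitIP/andP[] := unitI_brk N0 cC (ltn_ord k) (ltn_ord i) (ltnW (ltn_ord j)).
set a := brk N C k i j; set b := brk N C k i j.+1 => a0 _ ab.
have -> : `[a, b[ `&` `[0, v[ = `[a, Num.min v b[%classic.
  apply/seteqP; split => y /=; rewrite !in_itv/= lt_min.
    by move=> [/andP[-> ->] /andP[_ ->]].
  by move=> /and3P[ay -> ->]; rewrite ay (le_trans a0 ay).
rewrite lebesgue_measure_itv/= lte_fin /clip; case: ltP => [avb|].
  have av : a < v by rewrite (lt_le_trans avb)// ge_min lexx.
  by rewrite (min_r (ltW av)) EFinB.
rewrite ge_min => /orP[va|ba]; first by rewrite !min_l ?subrr// (le_trans va).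
have -> : b = a by apply/eqP; rewrite eq_le ab ba.
by rewrite subrr.
Qed.

Lemma cell_cdf_ge0 i (x : R) : 0 <= x -> 0 <= cell_cdf N i x.
Proof. by move=> x0; rewrite -(cell_cdf0 R N0 i) cell_cdf_le. Qed.

Lemma integral_checkerboard_kernel u1 u2 v : unitI u1 -> unitI u2 -> unitI v ->
  (\int[@lebesgue_measure R]_(t in Icc 0 v)
     checkerboard_kernel t (Icc 0 u1 `*` Icc 0 u2)
   = (checkerboard N C u1 u2 v)%:E)%E.
Proof.
move=> /unitIP/andP[u10 _] /unitIP/andP[u20 _] /unitIP/andP[v0 v1].
have mK : measurable_fun [set: measurableTypeR R]
    (fun t : measurableTypeR R => checkerboard_kernel t (Icc 0 u1 `*` Icc 0 u2)).
  apply: (measurable_kernel checkerboard_kernel).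
  by apply: measurableX; exact: measurable_itv.
(* Dropping the endpoint matters when [v = 1]: the point 1 lies in no piece, and the kernel there
   takes the default cell. *)
rewrite /Icc -integral_itv_bndo_bndc; last exact: measurable_funTS.
rewrite (eq_integral (fun t : measurableTypeR R => \sum_(m : cell)
    ((cell_cdf N m.1.2 u1 * cell_cdf N m.2 u2)%:E * (\1_(piece m) t)%:E))%E); last first.
  move=> t; rewrite inE/= in_itv/= => /andP[t0 tv].
  by rewrite checkerboard_kernel_sum// t0 (lt_le_trans tv).
have c0 (m : cell) : 0 <= cell_cdf N m.1.2 u1 * cell_cdf N m.2 u2.
  by rewrite mulr_ge0 ?cell_cdf_ge0.
have mS (m : cell) : measurable_fun (`[0, v[ : set (measurableTypeR R))
    (fun t : measurableTypeR R => (\1_(piece m) t)%:E).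
  apply/measurable_EFinP; apply: measurable_indic; exact: measurable_itv.
rewrite ge0_integral_sum//; first last.
- by move=> m t _; apply: mule_ge0; rewrite lee_fin; [exact: c0|].
- by move=> m; exact: measurable_funeM.
rewrite /checkerboard sum_cells -sumEFin; apply: eq_bigr => m _.
rewrite ge0_integralZl//; last by rewrite lee_fin.
rewrite integral_indic//; last exact: measurable_itv.
rewrite [in RHS]mulrC [in RHS]EFinM; congr (_ * _)%E; exact: lebesgue_piece.
Qed.

Lemma cond_kernel_checkerboard : cond_kernel (checkerboard N C) checkerboard_kernel.
Proof.
split=> [t|u1 u2 v Iu1 Iu2 Iv]; last by rewrite integral_checkerboard_kernel.
rewrite /unitI checkerboard_kernel_rect !(cell_cdf1 R N0) ?mulr1//; exact: ltn_ord.
Qed.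

Lemma C3c_checkerboard : C3c (checkerboard N C).
Proof.
split; first exact: copula3_checkerboard.
exists checkerboard_kernel; split; first exact: cond_kernel_checkerboard.
apply: aeW => t _; split.
  rewrite (_ : (fun u => _) = cell_cdf N (row t)); last first.
    by apply/funext => u; rewrite F13_checkerboard.
  by move=> x; apply: cvgM; [exact: cvg_cst|exact: continuous_clip].
rewrite (_ : (fun u => _) = cell_cdf N (col t)); last first.
  by apply/funext => u; rewrite F23_checkerboard.
by move=> x; apply: cvgM; [exact: cvg_cst|exact: continuous_clip].
Qed.

End CheckerboardKernel.

(** * Almost sure uniqueness of conditional kernels *)

Section KernelVersions.
Variables (R : realType) (C : R -> R -> R -> R).
Implicit Type K : R.-pker R ~> (R * R)%type.

(** With [u2 := 1] or [u1 := 1] this is convertible to [F13] or [F23], so its properties also cover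
    the conditional margins. *)
Definition rect_cdf K (u1 u2 t : R) : R := fine (K t (Icc 0 u1 `*` Icc 0 u2)).

Lemma measurable_rect (u1 u2 : R) : measurable (Icc 0 u1 `*` Icc 0 u2).
Proof. by apply: measurableX; exact: measurable_itv. Qed.

Lemma kernel_rect_le1 K u1 u2 t : (K t (Icc 0 u1 `*` Icc 0 u2) <= 1)%E.
Proof.
rewrite -(prob_kernel (s := K) t); apply: le_measure; rewrite ?inE//.
exact: measurable_rect.
Qed.

Lemma kernel_rectE K u1 u2 t :
  K t (Icc 0 u1 `*` Icc 0 u2) = (rect_cdf K u1 u2 t)%:E.
Proof.
rewrite /rect_cdf fineK// ge0_fin_numE//.
exact: le_lt_trans (kernel_rect_le1 K u1 u2 t) (ltry 1).
Qed.

Lemma rect_cdf01 K u1 u2 t : 0 <= rect_cdf K u1 u2 t <= 1.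
Proof. by rewrite -!lee_fin -kernel_rectE measure_ge0/= kernel_rect_le1. Qed.

Lemma measurable_rect_cdf K u1 u2 : measurable_fun [set: R] (rect_cdf K u1 u2).
Proof.
apply: measurableT_comp => //.
exact: measurable_kernel (measurable_rect u1 u2).
Qed.

Lemma Rintegral_rect_cdf K u1 u2 v : cond_kernel C K ->
  unitI u1 -> unitI u2 -> unitI v ->
  Rintegral (@lebesgue_measure R) (Icc 0 v) (rect_cdf K u1 u2) = C u1 u2 v.
Proof.
move=> [_ CK] Iu1 Iu2 Iv; rewrite /Rintegral.
under eq_integral do rewrite -kernel_rectE.
by rewrite -CK.
Qed.

(** Both sides have prefix integrals [C u1 u2 v]. The null set may depend on [u1] and [u2]. *)
Lemma cond_kernel_ae_unique K K' u1 u2 :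
  cond_kernel C K -> cond_kernel C K' -> unitI u1 -> unitI u2 ->
  {ae @lebesgue_measure R, forall t, unitI t ->
     rect_cdf K u1 u2 t = rect_cdf K' u1 u2 t}.
Proof.
move=> CK CK' Iu1 Iu2.
apply: ae_eq_prefix_integral; try exact: measurable_rect_cdf.
- exact: rect_cdf01.
- exact: rect_cdf01.
- by move=> v Iv; rewrite !Rintegral_rect_cdf.
Qed.

Lemma ae_eq_Rintegral (D : set (measurableTypeR R)) (f g : R -> R) :
  measurable D ->
  measurable_fun D (f : measurableTypeR R -> R) ->
  measurable_fun D (g : measurableTypeR R -> R) ->
  {ae @lebesgue_measure R, forall t, D t -> f t = g t} ->
  Rintegral (@lebesgue_measure R) D f = Rintegral (@lebesgue_measure R) D g.
Proof.
move=> mD mf mg fg; rewrite /Rintegral; congr fine.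
apply: ae_eq_integral => //; try exact/measurable_EFinP.
apply: (@filterS _ _ (ae_filter_ringOfSetsType lebesgue_measure)) fg.
by move=> t /= fg Dt; rewrite fg.
Qed.

End KernelVersions.

(** * The partial vine copula of a checkerboard copula *)

Section PsiCheckerboard.
Variables (R : realType) (N : nat) (C : R -> R -> R -> R).
Hypotheses (N0 : (0 < N)%N) (cC : copula3 C).

Let D := checkerboard N C.
Let K0 := checkerboard_kernel N0 cC.
Let row t : nat := (checkerboard_index C N0 t).1.2.
Let col t : nat := (checkerboard_index C N0 t).2.

(** [psi] falls back to 0 when no candidate exists, so one is exhibited: the independence copula for
    every [t], since the explicit kernel is the product of its margins. *)
Lemma is_psi_checkerboard : exists P, is_psi D P.
Proof.
exists (fun u1 u2 v => Rintegral (@lebesgue_measure R) (Icc 0 v)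
  (fun t => partial_copula (fun _ s1 s2 => s1 * s2) (F13 K0 u1 t) (F23 K0 u2 t))).
exists K0, (fun _ s1 s2 => s1 * s2); split; first exact: cond_kernel_checkerboard.
split=> //; split; first by move=> s1 s2; exact: measurable_cst.
apply: aeW => t _; split.
  split=> [u _|a1 b1 a2 b2 _ _ _ _ ab1 ab2].
    by rewrite !mul0r !mulr0 mulr1 mul1r.
  rewrite [leRHS](_ : _ = (b1 - a1) * (b2 - a2)); last by ring.
  by rewrite mulr_ge0// subr_ge0.
move=> u1 u2 _ _.
by rewrite checkerboard_kernel_rect F13_checkerboard F23_checkerboard.
Qed.

(** The [s]-quantile of the uniform law on cell side [i]. *)
Definition cell_point (i : nat) (s : R) : R := node R N i + s / N%:R.

Lemma cell_point_btw i s : unitI s ->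
  node R N i <= cell_point i s <= node R N i.+1.
Proof.
move=> /unitIP/andP[s0 s1]; rewrite lerDl divr_ge0//= -lerBrDl nodeS.
by rewrite ler_pdivrMr ?ltr0n// mulVf// pnatr_eq0 -lt0n.
Qed.

Lemma unitI_cell_point (i : 'I_N) s : unitI s -> unitI (cell_point i s).
Proof.
move=> /(cell_point_btw i)/andP[i0 i1]; apply/unitIP.
have /unitIP/andP[n0 _] := unitI_node R N0 (ltnW (ltn_ord i)).
have /unitIP/andP[_ n1] := unitI_node R N0 (ltn_ord i).
by rewrite (le_trans n0 i0) (le_trans i1 n1).
Qed.

Lemma cell_cdf_point i s : unitI s -> cell_cdf N i (cell_point i s) = s.
Proof.
move=> /(cell_point_btw i)/andP[i0 i1]; rewrite /cell_cdf /clip min_l// min_r//.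
by rewrite /cell_point addrAC subrr add0r mulrC divfK// pnatr_eq0 -lt0n.
Qed.

Lemma row_lt t : (row t < N)%N. Proof. exact: ltn_ord. Qed.
Lemma col_lt t : (col t < N)%N. Proof. exact: ltn_ord. Qed.

(* On the piece of index (k, i, j) the two conditional distribution functions
   are onto [0, 1], so every s is attained at one of the finitely many points
   (cell_point i s1, cell_point j s2). *)
Lemma cond_copula_checkerboard (K : R.-pker R ~> (R * R)%type) A s1 s2 :
  cond_kernel D K -> cond_copula K A -> unitI s1 -> unitI s2 ->
  {ae @lebesgue_measure R, forall t, unitI t -> A t s1 s2 = s1 * s2}.
Proof.
move=> DK [_ KA] Is1 Is2.
have DK0 := cond_kernel_checkerboard N0 cC.
have FF := ae_filter_ringOfSetsType (@lebesgue_measure R).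
have ae1 : {ae @lebesgue_measure R, forall t, forall i : 'I_N, unitI t ->
    rect_cdf K (cell_point i s1) 1 t = rect_cdf K0 (cell_point i s1) 1 t}.
  apply: filter_forall => i.
  by apply: (cond_kernel_ae_unique DK DK0) => //; exact: unitI_cell_point.
have ae2 : {ae @lebesgue_measure R, forall t, forall j : 'I_N, unitI t ->
    rect_cdf K 1 (cell_point j s2) t = rect_cdf K0 1 (cell_point j s2) t}.
  apply: filter_forall => j.
  by apply: (cond_kernel_ae_unique DK DK0) => //; exact: unitI_cell_point.
have ae3 : {ae @lebesgue_measure R, forall t, forall ij : 'I_N * 'I_N, unitI t ->
    rect_cdf K (cell_point ij.1 s1) (cell_point ij.2 s2) t
    = rect_cdf K0 (cell_point ij.1 s1) (cell_point ij.2 s2) t}.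
  apply: filter_forall => ij.
  by apply: (cond_kernel_ae_unique DK DK0) => //; exact: unitI_cell_point.
have ae12 := @filterI _ _ FF _ _ ae1 ae2.
refine (filterS3 FF _ ae12 ae3 KA).
move=> t [h1 h2] h3 h4 It.
pose i := Ordinal (row_lt t); pose j := Ordinal (col_lt t).
have [_ /(_ _ _ (unitI_cell_point i Is1) (unitI_cell_point j Is2))] := h4 It.
rewrite kernel_rectE (h3 (i, j) It)/=.
have -> : F13 K (cell_point i s1) t = s1.
  rewrite [LHS](h1 i It) [LHS]F13_checkerboard; exact: cell_cdf_point.
have -> : F23 K (cell_point j s2) t = s2.
  rewrite [LHS](h2 j It) [LHS]F23_checkerboard; exact: cell_cdf_point.
by rewrite /rect_cdf checkerboard_kernel_rect/= !cell_cdf_point// => -[].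
Qed.

Lemma partial_copula_checkerboard (K : R.-pker R ~> (R * R)%type) A s1 s2 :
  cond_kernel D K -> cond_copula K A -> unitI s1 -> unitI s2 ->
  partial_copula A s1 s2 = s1 * s2.
Proof.
move=> DK KA Is1 Is2; rewrite /partial_copula.
have mI : measurable (@unitI R : set (measurableTypeR R)) by exact: measurable_itv.
rewrite (@ae_eq_Rintegral R _ _ (cst (s1 * s2)) mI).
- rewrite Rintegral_cst// /unitI /Icc [X in fine X](_ : _ = 1%E) ?mulr1//.
  by rewrite [LHS]lebesgue_measure_itv/= lte_fin ltr01 oppr0 adde0.
- by have [mA _] := KA; exact: mA.
- exact: measurable_cst.
- exact: cond_copula_checkerboard DK KA Is1 Is2.
Qed.

(** The partial copula is the product, so [P] integrates the product of the margins of [K]. These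
    agree almost everywhere with the margins of the explicit kernel, whose product is its mass on
    the rectangle. *)
Lemma is_psi_checkerboardE P u1 u2 v : is_psi D P ->
  unitI u1 -> unitI u2 -> unitI v -> P u1 u2 v = D u1 u2 v.
Proof.
move=> [K [A [DK [KA ->]]]] Iu1 Iu2 Iv.
have DK0 := cond_kernel_checkerboard N0 cC.
have FF := ae_filter_ringOfSetsType (@lebesgue_measure R).
rewrite -[RHS](Rintegral_rect_cdf DK0 Iu1 Iu2 Iv).
transitivity (Rintegral (@lebesgue_measure R) (Icc 0 v)
  (fun t => rect_cdf K u1 1 t * rect_cdf K 1 u2 t)).
  apply: eq_Rintegral => t _; rewrite (partial_copula_checkerboard DK KA)//.
    exact/unitIP/rect_cdf01.
  exact/unitIP/rect_cdf01.
apply: ae_eq_Rintegral.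
- exact: measurable_itv.
- by apply: measurable_funTS; apply: measurable_funM; exact: measurable_rect_cdf.
- by apply: measurable_funTS; exact: measurable_rect_cdf.
have ae1 := cond_kernel_ae_unique DK DK0 Iu1 unitI1.
have ae2 := cond_kernel_ae_unique DK DK0 unitI1 Iu2.
apply: (@filterS2 _ _ FF) ae1 ae2 => t h1 h2; rewrite /Icc /= in_itv/= => /andP[t0 tv].
have It : unitI t.
  by apply/unitIP; rewrite t0 (le_trans tv)//; have /unitIP/andP[] := Iv.
rewrite h1// h2// /rect_cdf !checkerboard_kernel_rect/=.
by rewrite !(cell_cdf1 R N0) ?mulr1 ?mul1r.
Qed.

Lemma psi_checkerboard u1 u2 v : unitI u1 -> unitI u2 -> unitI v ->
  psi D u1 u2 v = D u1 u2 v.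
Proof.
move=> Iu1 Iu2 Iv; rewrite /psi; case: pselect => [h|]; last first.
  by move=> /(_ is_psi_checkerboard).
by case: (cid h) => P hP /=; exact: is_psi_checkerboardE.
Qed.

End PsiCheckerboard.

(** * The supremum distance *)

Section Dinf.
Variable R : realType.
Implicit Types C P : R -> R -> R -> R.

Let gaps C P := [set r | exists u1 u2 v : R, unitI u1 /\ unitI u2 /\ unitI v /\
  r = `|C u1 u2 v - P u1 u2 v|].

Lemma dinf_le C P c :
  (forall u1 u2 v, unitI u1 -> unitI u2 -> unitI v ->
     `|C u1 u2 v - P u1 u2 v| <= c) -> dinf C P <= c.
Proof.
move=> CPc; apply: ge_sup; last first.
  by move=> _ [u1 [u2 [v [Iu1 [Iu2 [Iv ->]]]]]]; exact: CPc.
by exists `|C 0 0 0 - P 0 0 0|, 0, 0, 0.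
Qed.

Lemma le_dinf C P u1 u2 v : has_ubound (gaps C P) ->
  unitI u1 -> unitI u2 -> unitI v -> `|C u1 u2 v - P u1 u2 v| <= dinf C P.
Proof.
by move=> ub Iu1 Iu2 Iv; apply: ub_le_sup => //; exists u1, u2, v.
Qed.

(** [sup] is 0 by convention on a set that has no supremum, so a nonzero value already entails
    boundedness. *)
Lemma dinf_neq0_ubound C P : dinf C P <> 0 -> has_ubound (gaps C P).
Proof.
move=> CP0; apply: contrapT => nub; apply: CP0.
by rewrite /dinf sup_out// => -[].
Qed.

End Dinf.

Theorem theorem6p1 (R : realType) (C : R -> R -> R -> R) :
  C3c C -> dinf C (psi C) <> 0 ->
  ~ (forall e : R, 0 < e -> exists2 d : R, 0 < d &
       forall D : R -> R -> R -> R, C3c D -> dinf C D < d ->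
         dinf (psi C) (psi D) < e).
Proof.
move=> [cC _] s0 psi_cont.
have le_s u1 u2 v := @le_dinf R C (psi C) u1 u2 v (dinf_neq0_ubound s0).
move: s0 le_s; set s := dinf C (psi C) => s0 le_s.
have spos : 0 < s.
  rewrite lt_neqAle eq_sym; apply/andP; split; first exact/eqP.
  exact: le_trans (normr_ge0 _) (le_s 0 0 0 unitI0 unitI0 unitI0).
have [|d d0 near_psi] := psi_cont (s / 2); first by rewrite divr_gt0.
(* The bound [3 / N < d] puts the approximant in the neighbourhood given by continuity;
   [3 / N < s / 2] makes the final inequality read [s < s / 2 + s / 2]. *)
pose m := Num.min d (s / 2).
have m0 : 0 < m by rewrite lt_min d0 divr_gt0.
pose N := Num.bound (3 / m).
have mN : 3 / m < N%:R by apply: archi_boundP; rewrite divr_ge0// ltW.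
have N0 : (0 < N)%N.
  by rewrite -(ltr_nat R) (le_lt_trans _ mN)// divr_ge0// ltW.
have Nm : 3 / N%:R < m by rewrite ltr_pdivrMr ?ltr0n// mulrC -ltr_pdivrMr.
have /andP[Nd Ns] : (3 / N%:R < d) && (3 / N%:R < s / 2) by rewrite -lt_min.
set D := checkerboard N C.
have closeD u1 u2 v := @checkerboard_close R N C N0 cC u1 u2 v.
have CD : dinf C D < d by apply: le_lt_trans Nd; exact: dinf_le.
have psiD u1 u2 v : unitI u1 -> unitI u2 -> unitI v ->
  psi D u1 u2 v = D u1 u2 v by exact: psi_checkerboard.
have psiCD := near_psi D (C3c_checkerboard N0 cC) CD.
have gapCD u1 u2 v : unitI u1 -> unitI u2 -> unitI v ->
    `|psi C u1 u2 v - psi D u1 u2 v| <= dinf (psi C) (psi D).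
  (* The gaps are bounded by passing through [C]: [psi C] is within [s] of it and [psi D = D] within
     [3 / N]. *)
  apply: le_dinf; exists (s + 3 / N%:R).
  move=> _ [x1 [x2 [y [Ix1 [Ix2 [Iy ->]]]]]]; rewrite psiD//.
  rewrite (le_trans (ler_distD (C x1 x2 y) _ _))// lerD ?closeD//.
  by rewrite distrC le_s.
have : s <= 3 / N%:R + dinf (psi C) (psi D).
  apply: dinf_le => u1 u2 v Iu1 Iu2 Iv.
  rewrite (le_trans (ler_distD (D u1 u2 v) _ _))// lerD ?closeD//.
  by rewrite distrC -psiD// gapCD.
by lra.
Qed.
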